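(* Let $n\ge 1$ and let $(\xi_i,\mathcal{F}_i)_{i=0,\dots,n}$ be a sequence of real-valued martingale differences on a probability space $(\Omega,\mathcal{F},\mathbf{P})$, with $\xi_0=0$, $\{\emptyset,\Omega\}=\mathcal{F}_0\subseteq\cdots\subseteq\mathcal{F}_n\subseteq\mathcal{F}$ and $\mathbf{E}[\xi_i\mid\mathcal{F}_{i-1}]=0$ for $i=1,\dots,n$. Let $S_k=\sum_{i=1}^k\xi_i$. Let $\alpha\in(0,1)$ and assume $$C_n:=\sum_{i=1}^n\mathbf{E}\big[\xi_i^2\exp\{(\xi_i^+)^\alpha\}\big]<\infty .$$ Define $\Upsilon(S)_k=\sum_{i=1}^k\mathbf{E}\big[\xi_i^2\exp\{(\xi_i^+)^\alpha\}\mid\mathcal{F}_{i-1}\big]$ for $k\in[1,n]$. Then for all $x,u>0$, $$\mathbf{P}\big(S_k\ge x \text{ and } \Upsilon(S)_k\le u \text{ for some } k\in[1,n]\big)\le \begin{cases} \exp\Big\{-\dfrac{x^2}{2u}\Big\}+C_n\Big(\dfrac{x}{u}\Big)^{2/(1-\alpha)}\exp\Big\{-\Big(\dfrac{u}{x}\Big)^{\alpha/(1-\alpha)}\Big\} & \text{if } 0\le x<u^{1/(2-\alpha)},\\[2mm] \exp\Big\{-x^\alpha\Big(1-\dfrac{u}{2x^{2-\alpha}}\Big)\Big\}+\dfrac{C_n}{x^2}\exp\{-x^\alpha\} & \text{if } x\ge u^{1/(2-\alpha)}. \end{cases}$$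
   Context: $x^+=\max\{x,0\}$. *)

(* Defs.v *)
From HB Require Import structures.
From mathcomp Require Import all_boot all_order all_algebra.
From mathcomp Require Import all_classical all_reals all_analysis.
Set Implicit Arguments. Unset Strict Implicit. Unset Printing Implicit Defensive.
Import Order.TTheory GRing.Theory Num.Theory.
Local Open Scope classical_set_scope.
Local Open Scope ring_scope.

Definition measurable_wrt {T : Type} {R : realType}
  (G : set (set T)) (f : T -> R) : Prop :=
  forall B : set R, measurable B -> G (f @^-1` B).

Definition filtration_upto d (T : measurableType d) (n : nat)
  (F : nat -> set (set T)) : Prop :=
  [/\ (forall i, (i <= n)%N -> sigma_algebra setT (F i)),
      F 0%N = [set set0; setT],
      (forall i, (i < n)%N -> F i `<=` F i.+1) &
      F n `<=` measurable].

Definition cond_exp_version d (T : measurableType d) (R : realType)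
  (P : probability T R) (G : set (set T)) (f g : T -> R) : Prop :=
  [/\ measurable_wrt G g,
      P.-integrable setT (EFin \o g) &
      forall A, G A -> (\int[P]_(w in A) (g w)%:E = \int[P]_(w in A) (f w)%:E)%E].

Definition mart_diff d (T : measurableType d) (R : realType)
  (P : probability T R) (n : nat) (F : nat -> set (set T))
  (xi : nat -> T -> R) : Prop :=
  [/\ xi 0%N = (fun=> 0),
      (forall i, (i <= n)%N -> measurable_wrt (F i) (xi i)),
      (forall i, (i <= n)%N -> P.-integrable setT (EFin \o xi i)) &
      (forall i, (1 <= i <= n)%N ->
         cond_exp_version P (F i.-1) (xi i) (fun=> 0))].

Definition partial_sum {T : Type} {R : realType} (xi : nat -> T -> R)
  (k : nat) (w : T) : R := \sum_(1 <= i < k.+1) xi i w.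

Definition wsq {T : Type} {R : realType} (alpha : R) (xi : nat -> T -> R)
  (i : nat) (w : T) : R :=
  xi i w ^+ 2 * expR (powR (Num.max (xi i w) 0) alpha).

(* Main.v *)
(* Fix y > 0, put lam = y^(alpha-1) and truncate: eta_i = min(xi_i, y). From
   e^t <= 1 + t + (t^2/2) e^(t^+) and lam eta_i^+ <= (xi_i^+)^alpha one gets
     e^(lam eta_i) <= 1 + lam xi_i + (lam^2/2) xi_i^2 exp{(xi_i^+)^alpha},
   so exp(lam sum eta_i - (lam^2/2) Ups) is a supermartingale and the maximal
   inequality gives exp(-lam x + lam^2 u/2) for the truncated walk. The
   truncation acts only if some xi_i > y, an event of probability at most
   C_n y^-2 exp(-y^alpha) by Markov's inequality. The two cases are
   y = (u/x)^(1/(1-alpha)) and y = x. *)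
Require Import Defs.
From HB Require Import structures.
From mathcomp Require Import all_boot all_order all_algebra.
From mathcomp Require Import all_classical all_reals all_analysis.
From mathcomp Require Import measurable_realfun ring.
Import Order.TTheory GRing.Theory Num.Theory.
Local Open Scope classical_set_scope.
Local Open Scope ring_scope.
Import HBNNSimple numFieldNormedType.Exports.

(** * Measurability and integration relative to a sub-sigma-algebra *)

(** Gives [measurable_wrt] the closure properties of [measurable_fun] (sums, products, minima,
    compositions), since a sigma-algebra generates itself. *)
Lemma measurable_wrtP {d} {T : measurableType d} {R : realType}
  {G : set (set T)} (f : T -> R) : sigma_algebra setT G ->
  measurable_wrt G f <->
  measurable_fun [set: g_sigma_algebraType G] (f : g_sigma_algebraType G -> R).
Proof.
move=> sG; split=> [Gf _ B mB|mf B mB].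
- by rewrite setTI (measurable_g_measurableTypeE sG); exact: Gf.
- by have := mf measurableT B mB; rewrite setTI (measurable_g_measurableTypeE sG).
Qed.

Lemma measurable_wrtS {T : Type} {R : realType} (G H : set (set T))
  (f : T -> R) : G `<=` H -> measurable_wrt G f -> measurable_wrt H f.
Proof. by move=> GH Gf B mB; exact/GH/Gf. Qed.

Lemma measurable_wrt_fun {d} {T : measurableType d} {R : realType}
  (G : set (set T)) (f : T -> R) : G `<=` measurable ->
  measurable_wrt G f -> measurable_fun setT f.
Proof. by move=> Gm Gf _ B mB; rewrite setTI; exact/Gm/Gf. Qed.

(** Linearity passes from sets of [G] to [G]-simple weights, and monotone convergence to all
    nonnegative [G]-measurable weights. This plays the part of taking a known factor out of a
    conditional expectation, and it allows infinite integrals. *)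
Lemma ge0_le_integral_weight {d} {T : measurableType d} {R : realType}
  (mu : {measure set T -> \bar R}) (G : set (set T)) (f g h : T -> R) :
  sigma_algebra setT G -> G `<=` measurable ->
  measurable_fun setT f -> measurable_fun setT g ->
  (forall x, 0 <= f x) -> (forall x, 0 <= g x) ->
  (forall A, G A ->
     (\int[mu]_(x in A) (f x)%:E <= \int[mu]_(x in A) (g x)%:E)%E) ->
  measurable_wrt G h -> (forall x, 0 <= h x) ->
  (\int[mu]_x (h x * f x)%:E <= \int[mu]_x (h x * g x)%:E)%E.
Proof.
move=> sG Gm mf mg f0 g0 fg Gh h0.
have /measurable_EFinP mh := (measurable_wrtP h sG).1 Gh.
(* The approximation is built on [g_sigma_algebraType G], not on [T], so that the level sets of the
   simple functions lie in [G], where [fg] applies. *)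
pose hs := nnsfun_approx measurableT mh.
pose hn k : T -> R := hs k.
have Ghn k : measurable_wrt G (hn k).
  by apply/measurable_wrtP => //; exact: measurable_funP.
have G_level k r : G (hn k @^-1` [set r]) by exact: Ghn.
have hn0 k x : 0 <= hn k x by exact: fun_ge0.
have mhn k : measurable_fun setT (hn k).
  exact: (@measurable_wrt_fun _ _ _ G).
have lim_int (p : T -> R) : measurable_fun setT p -> (forall x, 0 <= p x) ->
    (\int[mu]_x (hn k x * p x)%:E)%E @[k --> \oo] -->
    (\int[mu]_x (h x * p x)%:E)%E.
  move=> mp p0.
  have -> : (\int[mu]_x (h x * p x)%:E =
      \int[mu]_x limn (fun k => (hn k x * p x)%:E))%E.
    apply: eq_integral => x _; apply/esym/cvg_lim => //.
    under eq_fun do rewrite EFinM.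
    rewrite EFinM; apply: cvgeZr => //.
    by apply: (cvg_nnsfun_approx measurableT mh) => // y _; rewrite lee_fin.
  apply: (@cvg_monotone_convergence _ _ _ mu setT measurableT
    (fun k x => (hn k x * p x)%:E)).
  - by move=> k; apply/measurable_EFinP; apply: measurable_funM.
  - by move=> k x _; rewrite lee_fin mulr_ge0.
  - move=> x _ k l kl; rewrite lee_fin ler_wpM2r//.
    exact/lefP/(@nd_nnsfun_approx _ _ _ _ measurableT _ mh).
have int_simple k (p : T -> R) : measurable_fun setT p -> (forall x, 0 <= p x) ->
    (\int[mu]_x (hn k x * p x)%:E = \sum_(r \in range (hn k))
       r%:E * \int[mu]_(x in hn k @^-1` [set r]) (p x)%:E)%E.
  move=> mp p0.
  have range0 r : range (hn k) r -> 0 <= r by move=> [x _ <-].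
  have finr : finite_set (range (hn k)) by exact: (fimfunP (hs k)).
  have mind r : measurable_fun setT (\1_(hn k @^-1` [set r]) : T -> R).
    by apply: measurable_indic; exact: Gm.
  transitivity (\int[mu]_x \sum_(r \in range (hn k))
      (r%:E * ((\1_(hn k @^-1` [set r]) x)%:E * (p x)%:E)))%E.
    apply: eq_integral => x _.
    under eq_fsbigr do rewrite muleA.
    rewrite -(ge0_mule_fsuml _ (F := fun r =>
        r%:E * (\1_(hn k @^-1` [set r]) x)%:E)%E); last first.
      by move=> r; exact: nnfun_muleindic_ge0.
    under eq_fsbigr do rewrite -EFinM.
    rewrite fsumEFin // EFinM; congr (_%:E * _)%E.
    exact: (fimfunE (hs k)).
  rewrite ge0_integral_fsum//; last 2 first.
  - move=> r; apply/measurable_EFinP.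
    apply: measurable_funM => //; exact: measurable_funM.
  - move=> r x _; rewrite muleA mule_ge0 ?lee_fin //.
    exact: nnfun_muleindic_ge0.
  apply: eq_fsbigr => r /[1!inE] /range0 r0.
  rewrite ge0_integralZl_EFin//; last 2 first.
  - by move=> x _; rewrite mule_ge0 ?lee_fin.
  - by apply/measurable_EFinP; exact: measurable_funM.
  rewrite [in RHS]integral_mkcond epatch_indic.
  by congr (_ * _)%E; apply: eq_integral => x _ /=; rewrite muleC.
have cf := lim_int f mf f0; have cg := lim_int g mg g0.
rewrite -(cvg_lim _ cf)// -(cvg_lim _ cg)//.
apply: lee_lim; [exact: cvgP cf|exact: cvgP cg|].
apply: nearW => k; rewrite !int_simple//.
apply: lee_fsum; first exact: (fimfunP (hs k)).
by move=> r [x _ <-]; rewrite lee_wpmul2l ?lee_fin// fg.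
Qed.

(** * Filtrations and the maximal inequality *)

Lemma filtration_upto_measurable {d} {T : measurableType d} (n : nat)
  (F : nat -> set (set T)) (k : nat) :
  filtration_upto n F -> (k <= n)%N -> F k `<=` measurable.
Proof.
move=> [_ _ incF Fn] kn; apply: subset_trans Fn.
have incFD m : (k + m <= n)%N -> F k `<=` F (k + m)%N.
  elim: m => [|m ih]; first by rewrite addn0 => _ A.
  rewrite addnS => km; exact: subset_trans (ih (ltnW km)) (incF _ km).
by have := incFD (n - k)%N; rewrite subnKC//; exact.
Qed.

(** The exponential of the sum of [s i - v i] is a supermartingale, because [v i] is predictable;
    stopping it when the sum first reaches [t] gives the bound. The supermartingale property enters
    through integrals over sets of [F i.-1], so no version of the conditional expectation of
    [expR (s i)] has to be chosen. *)
Lemma exp_supermartingale_maximal {d} {T : measurableType d} {R : realType}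
  (P : probability T R) (n : nat) (F : nat -> set (set T))
  (s v : nat -> T -> R) (t : R) :
  filtration_upto n F ->
  (forall i, (1 <= i <= n)%N -> measurable_wrt (F i) (s i)) ->
  (forall i, (1 <= i <= n)%N -> measurable_wrt (F i.-1) (v i)) ->
  (forall i, (1 <= i <= n)%N -> forall A, F i.-1 A ->
     (\int[P]_(w in A) (expR (s i w))%:E <=
      \int[P]_(w in A) (expR (v i w))%:E)%E) ->
  (P [set w | exists k, (1 <= k <= n)%N /\
        (t <= \sum_(1 <= i < k.+1) (s i w - v i w))%R] <= (expR (- t))%:E)%E.
Proof.
move=> Ffilt ms mv sv; have [sF _ incF _] := Ffilt.
have Fm k : (k <= n)%N -> F k `<=` measurable.
  exact: filtration_upto_measurable Ffilt.
pose S k w := \sum_(1 <= i < k.+1) (s i w - v i w).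
(* The level [t] has not been reached up to time [k]; [B 0] is the whole space, as the range of [j]
   is then empty. *)
pose B k := [set w | forall j, (1 <= j <= k)%N -> S j w < t].
have S_rec k w : S k.+1 w = S k w + (s k.+1 w - v k.+1 w).
  by rewrite /S big_nat_recr.
have mS k : (k <= n)%N -> measurable_wrt (F k) (S k).
  elim: k => [_|k ih kn].
    apply/(measurable_wrtP _ (sF _ _)) => //.
    rewrite (_ : S 0%N = cst 0); first exact: measurable_cst.
    by apply/funext => w; rewrite /S big_geq.
  apply/(measurable_wrtP _ (sF _ kn)).
  rewrite (_ : S k.+1 = S k \+ (s k.+1 \- v k.+1)); last first.
    by apply/funext => w; exact: S_rec.
  apply: measurable_funD; last apply: measurable_funB;
    apply/(measurable_wrtP _ (sF _ kn)).
  - exact: measurable_wrtS (incF _ kn) (ih (ltnW kn)).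
  - exact: ms.
  - by apply: measurable_wrtS (incF _ kn) _; exact: (mv k.+1).
have B_rec k : B k.+1 = B k `&` [set w | S k.+1 w < t].
  apply/seteqP; split=> w /=.
    move=> Bw; split; last by apply: Bw; rewrite /= ltnSn.
    by move=> j /andP[j1 jk]; apply: Bw; rewrite j1 ltnW.
  move=> [Bw Sw] j /andP[j1]; rewrite leq_eqVlt => /predU1P[-> //|].
  by rewrite ltnS => jk; apply: Bw; rewrite j1.
have FB k : (k <= n)%N -> F k (B k).
  elim: k => [_|k ih kn].
    rewrite -(measurable_g_measurableTypeE (sF _ (leq0n n))).
    rewrite (_ : B 0%N = setT); first exact: measurableT.
    by apply/seteqP; split=> // w _ j /andP[/leq_trans/[apply]].
  rewrite B_rec -(measurable_g_measurableTypeE (sF _ kn)).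
  apply: measurableI; rewrite (measurable_g_measurableTypeE (sF _ kn)).
    exact/(incF _ kn)/ih/ltnW.
  rewrite (_ : [set _ | _] = S k.+1 @^-1` `]-oo, t[%classic); first exact: mS.
  by apply/seteqP; split=> w /=; rewrite in_itv.
have mB k : (k <= n)%N -> measurable (B k) by move=> kn; exact/(Fm _ kn)/FB.
have meS k : (k <= n)%N -> measurable_fun setT (fun w => expR (S k w)).
  move=> kn; apply: measurableT_comp => //.
  exact: measurable_wrt_fun (Fm _ kn) (mS _ kn).
have step k : (k < n)%N ->
    (\int[P]_(w in B k) (expR (S k.+1 w))%:E <=
     \int[P]_(w in B k) (expR (S k w))%:E)%E.
  (* This weight is [F k]-measurable and common to both sides: [S k.+1] is [S k - v k.+1] plus
     [s k.+1], and [S k] is the same quantity plus [v k.+1]. *)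
  move=> kn; pose h w := \1_(B k) w * expR (S k w - v k.+1 w).
  have hE q : (\int[P]_(w in B k) (expR (S k w - v k.+1 w + q w))%:E =
      \int[P]_w (h w * expR (q w))%:E)%E.
    rewrite integral_mkcond epatch_indic; apply: eq_integral => w _ /=.
    by rewrite -EFinM expRD /h; congr _%:E; ring.
  under eq_integral do rewrite S_rec addrA addrAC.
  under [leRHS]eq_integral => w _ do rewrite -[S k w](subrK (v k.+1 w)).
  rewrite !hE.
  apply: (@ge0_le_integral_weight _ _ _ _ (F k)).
  - exact/sF/ltnW.
  - exact/Fm/ltnW.
  - apply: measurableT_comp => //.
    by apply: measurable_wrt_fun (Fm _ kn) _; exact: ms.
  - apply: measurableT_comp => //.
    by apply: measurable_wrt_fun (Fm _ (ltnW kn)) _; exact: (mv k.+1).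
  - by move=> w; exact: expR_ge0.
  - by move=> w; exact: expR_ge0.
  - exact: (sv k.+1).
  - apply/(measurable_wrtP _ (sF _ (ltnW kn))); apply: measurable_funM.
      apply: measurable_indic.
      by rewrite (measurable_g_measurableTypeE (sF _ (ltnW kn))); exact/FB/ltnW.
    apply: measurableT_comp => //.
    apply: measurable_funB; apply/(measurable_wrtP _ (sF _ (ltnW kn))).
      exact/mS/ltnW.
    exact: (mv k.+1).
  - by move=> w; rewrite mulr_ge0 ?expR_ge0.
(* The invariant says that the stopped process has expectation at most 1. *)
have inv k : (k <= n)%N -> ((expR t)%:E * P (~` B k) +
    \int[P]_(w in B k) (expR (S k w))%:E <= 1)%E.
  elim: k => [_|k ih kn].
    have -> : B 0%N = setT.
      by apply/seteqP; split=> // w _ j /andP[/leq_trans/[apply]].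
    rewrite setCT measure0 mule0 add0e.
    under eq_integral do rewrite /S big_geq// expR0.
    by rewrite integral_cst// mul1e probability_le1.
  apply: le_trans (ih (ltnW kn)); apply: le_trans (leeD2l _ (step _ kn)).
  pose D := B k `&` [set w | t <= S k.+1 w].
  have mD : measurable D.
    apply: measurable_fun_le => //; first exact/mB/ltnW.
    apply: measurable_funTS.
    exact: measurable_wrt_fun (Fm _ kn) (mS _ kn).
  have CB : ~` B k.+1 = ~` B k `|` D.
    rewrite B_rec setCI /D setUIr [X in X `&` _]setUC setUv setTI.
    congr (_ `|` _); apply/seteqP; split=> w /=; rewrite ltNge.
      by move/negP; rewrite negbK.
    by move=> tS; apply/negP; rewrite negbK.
  have BU : B k = B k.+1 `|` D.
    rewrite B_rec /D -setIUr -[LHS]setIT; congr (_ `&` _).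
    by apply/seteqP; split=> // w _ /=; case: ltP => _; [left|right].
  rewrite CB measureU//; last 2 first.
  - exact/measurableC/mB/ltnW.
  - by rewrite /D setIA setICl set0I.
  rewrite ge0_muleDr// -addeA leeD2l// BU ge0_integral_setU//; last 3 first.
  - exact: mB.
  - by apply/measurable_EFinP/measurable_funTS/meS.
  - rewrite B_rec /D; apply/disj_setPS => w [[_ /= Sw] [_ /=]].
    by rewrite leNgt Sw.
  rewrite addeC leeD2l// -integral_cst//; apply: ge0_le_integral => //.
  - by move=> w _; rewrite /= lee_fin expR_ge0.
  - by apply/measurable_EFinP/measurable_funTS/meS.
  - by move=> w [_ /= tS]; rewrite lee_fin ler_expR.
rewrite expRN -[leRHS]mule1 lee_pdivlMl ?expR_gt0//.
apply: le_trans (inv n (leqnn n)); rewrite (_ : [set _ | _] = ~` B n).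
  by rewrite leeDl// integral_ge0.
apply/seteqP; split=> w /=.
  by move=> [k [kn tS]] /(_ k kn); rewrite ltNge tS.
move=> /existsNP[k /not_implyP[kn /negP]]; rewrite -leNgt => tS.
by exists k.
Qed.

(** * Exponential inequalities on the real line *)

(** Each sign of [t] reduces to a function that is nondecreasing on the half-line. For [t >= 0] the
    inequality is first multiplied by [expR (- t)]; for [t <= 0] the weight is 1 and the variable is
    [s = - t]. *)
Lemma expR_le_taylor2 {R : realType} (t : R) :
  expR t <= 1 + t + t ^+ 2 / 2 * expR (Num.max t 0).
Proof.
have mono (k k' : R -> R) : (forall s : R, is_derive s (1 : R) k (k' s)) ->
    (forall s, 0 < s -> 0 <= k' s) -> forall s, 0 <= s -> k 0 <= k s.
  move=> dk k'0 s s0; apply: (@ger0_derive1_ndecry _ k 0) => //.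
  - by move=> r; rewrite in_itv /= andbT => r0; rewrite derive1E derive_val k'0.
  - by apply: derivable_within_continuous => r _; exact: ex_derive.
have [t0|/ltW t0] := leP 0 t.
  pose k s : R := (1 + s) * expR (- s) + s ^+ 2 / 2.
  have /mono/(_ _ _ t0) : forall s : R, 
      is_derive s (1 : R) k (s * (1 - expR (- s))).
    by move=> s; apply: is_derive_eq; rewrite /GRing.scale/=; field.
  rewrite {1}/k oppr0 expR0 addr0 mulr1 expr0n/= mul0r addr0 => k1.
  have {k1}/(ler_wpM2r (expR_ge0 t)) : 1 <= k t.
    apply: k1 => s s0; rewrite mulr_ge0 ?(ltW s0)// subr_ge0 -expR0 ler_expR.
    by rewrite oppr_le0 ltW.
  by rewrite /k mul1r mulrDl -(mulrA (1 + t)) -expRD addNr expR0 mulr1.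
pose k s : R := 1 - s + s ^+ 2 / 2 - expR (- s).
have s0 : 0 <= - t by rewrite oppr_ge0.
have /mono/(_ _ _ s0) : forall s : R, is_derive s (1 : R) k (expR (- s) - (1 - s)).
  by move=> s; apply: is_derive_eq; rewrite /GRing.scale/=; field.
rewrite /k expR0 mulr1 oppr0 expR0 !opprK sqrrN expr0n/= mul0r !addr0 subrr.
rewrite subr_ge0; apply => s _.
by rewrite subr_ge0 expR_ge1Dx.
Qed.

(** Only the left side is truncated: the linear term keeps [z] itself, whose conditional mean will
    vanish. The value of [lam] is the largest one for which [lam * m <= m^alpha] on all of
    [0 < m <= y]. *)
Lemma expR_trunc_le {R : realType} (alpha y z : R) :
  0 < alpha < 1 -> 0 < y ->
  let lam := y `^ (alpha - 1) in
  expR (lam * Num.min z y) <= 1 + lam * z +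
    lam ^+ 2 / 2 * (z ^+ 2 * expR (Num.max z 0 `^ alpha)).
Proof.
move=> /andP[a0 a1] y0 /=; set lam := y `^ _.
have lam0 : 0 < lam by exact: powR_gt0.
apply: le_trans (expR_le_taylor2 _) _; apply: lerD.
  by rewrite lerD2l ler_pM2l// ge_min lexx.
have sq_min : Num.min z y ^+ 2 <= z ^+ 2.
  have [//|yz] := leP z y.
  by apply: lerXn2r; rewrite ?nnegrE ltW// (lt_trans y0).
have exp_min : Num.max (lam * Num.min z y) 0 <= Num.max z 0 `^ alpha.
  rewrite ge_max powR_ge0 andbT; have [z0|z0] := leP z 0.
    apply: le_trans (powR_ge0 _ _).
    by rewrite pmulr_rle0// ge_min z0.
  have m0 : 0 < Num.min z y by rewrite lt_min z0.
  (* With [m = min z y], the second factor is [(m / y)^(1 - alpha)], which is at most 1. *)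
  have -> : lam * Num.min z y = Num.min z y `^ alpha *
      (Num.min z y `^ (1 - alpha) * lam).
    rewrite mulrA -powRD; last by rewrite (gt_eqF m0) implybT.
    by rewrite addrC subrK powRr1 1?mulrC// ltW.
  rewrite -[leRHS]mulr1; apply: ler_pM; rewrite ?powR_ge0//.
  - by rewrite mulr_ge0 ?powR_ge0.
  - by apply: ge0_ler_powR; rewrite ?nnegrE ?ge_min ?lexx// ltW.
  - rewrite /lam -(opprB 1 alpha) powRN ler_pdivrMr ?powR_gt0// mul1r.
    by apply: ge0_ler_powR; rewrite ?nnegrE ?subr_ge0 ?ge_min ?lexx ?orbT// ltW.
rewrite exprMn (mulrAC (lam ^+ 2)) -(mulrA (lam ^+ 2 / 2)) ler_wpM2l//.
  by rewrite divr_ge0 ?sqr_ge0.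
by apply: ler_pM; rewrite ?sqr_ge0 ?expR_ge0 ?ler_expR.
Qed.

(** * Conditional exponential moments and large jumps *)

(** Integrating the pointwise bound over [A] in [G] removes [X] and turns [W] into [V]; then
    [1 + m V <= expR (m V)]. *)
Lemma cond_exp_expR_le {d} {T : measurableType d} {R : realType}
  (P : probability T R) (G : set (set T)) (f X W V : T -> R) (l m : R)
  (A : set T) :
  measurable_fun setT f -> (forall w, 0 <= f w) ->
  (forall w, f w <= 1 + l * X w + m * W w) ->
  P.-integrable setT (EFin \o X) -> P.-integrable setT (EFin \o W) ->
  cond_exp_version P G X (fun=> 0) -> cond_exp_version P G W V ->
  G A -> measurable A ->
  (\int[P]_(w in A) (f w)%:E <= \int[P]_(w in A) (expR (m * V w))%:E)%E.
Proof.
move=> mf f0 fle iX iW [_ i0 X0] [_ iV WV] GA mA.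
have iA (Y : T -> R) : P.-integrable setT (EFin \o Y) ->
    P.-integrable A (EFin \o Y).
  exact: integrableS.
have i1 : P.-integrable A (EFin \o cst 1).
  exact: finite_measure_integrable_cst.
have iZ (c : R) (Y : T -> R) : P.-integrable setT (EFin \o Y) ->
    P.-integrable A (fun w => (c * Y w)%:E).
  by move=> /iA iY; under eq_fun do rewrite EFinM; exact: integrableZl.
have lin (Y Z : T -> R) : P.-integrable setT (EFin \o Y) ->
    P.-integrable setT (EFin \o Z) ->
    (\int[P]_(w in A) (1 + l * Y w + m * Z w)%:E =
     P A + l%:E * \int[P]_(w in A) (Y w)%:E +
     m%:E * \int[P]_(w in A) (Z w)%:E)%E.
  move=> iY iZ'; under eq_integral do rewrite EFinD.
  rewrite integralD//; last 2 first.
  - under eq_fun do rewrite EFinD; apply: integrableD => //; exact: iZ.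
  - exact: iZ.
  under eq_integral do rewrite EFinD.
  rewrite integralD//; last exact: iZ.
  rewrite integral_cst// mul1e.
  under eq_integral do rewrite EFinM.
  under [X in (_ + _ + X)%E]eq_integral do rewrite EFinM.
  by rewrite !integralZl//; exact: iA.
have mX : measurable_fun setT X by exact/measurable_EFinP/(measurable_int _ iX).
have mW : measurable_fun setT W by exact/measurable_EFinP/(measurable_int _ iW).
have mV : measurable_fun setT V by exact/measurable_EFinP/(measurable_int _ iV).
have mlin (Y Z : T -> R) : measurable_fun setT Y -> measurable_fun setT Z ->
    measurable_fun A (fun w => (1 + l * Y w + m * Z w)%:E).
  move=> mY mZ; apply/measurable_EFinP/measurable_funTS.
  apply: measurable_funD; last exact: measurable_funM.
  apply: measurable_funD => //; exact: measurable_funM.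
apply: (@le_trans _ _ (\int[P]_(w in A) (1 + l * X w + m * W w)%:E)%E).
  apply: ge0_le_integral => //.
  - by move=> w _; rewrite lee_fin.
  - exact/measurable_EFinP/measurable_funTS.
  - exact: mlin.
  - by move=> w _; rewrite lee_fin.
(* The integral is split for the pair [X], [W] and reassembled for the pair [0], [V]. *)
rewrite lin// -X0// -WV// -lin//.
(* [V] is only a version, possibly negative on a null set, and [expR (m * V)]
   need not be integrable: compare through the positive part. *)
rewrite integralE.
apply: (@le_trans _ _ (\int[P]_(w in A)
    ((fun w => (1 + l * 0 + m * V w)%:E)^\+ w))%E).
  by rewrite geeDl// oppe_le0 integral_ge0.
have mg : measurable_fun A (fun w => (1 + l * 0 + m * V w)%:E).
  exact: (mlin (fun=> 0) V).
apply: ge0_le_integral => //.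
- exact: measurable_funepos.
- apply/measurable_EFinP/measurable_funTS; apply: measurableT_comp => //.
  exact: measurable_funM.
- move=> w _; rewrite funeposE ge_max !lee_fin expR_ge0 andbT mulr0 addr0.
  exact: expR_ge1Dx.
Qed.

(** Markov's inequality: where [y < X], both factors of the weight are at least their values at [y],
    so [K] times the weight is at least 1. *)
Lemma weighted_tail_le {d} {T : measurableType d} {R : realType}
  (P : probability T R) (alpha y : R) (X : T -> R) :
  0 <= alpha -> 0 < y -> measurable_fun setT X ->
  (P [set w | (y < X w)%R] <=
   \int[P]_w (X w ^+ 2 * expR (Num.max (X w) 0 `^ alpha))%:E *
   (y ^- 2 * expR (- (y `^ alpha)))%:E)%E.
Proof.
move=> a0 y0 mX; set K := y ^- 2 * _.
have K0 : 0 <= K by rewrite mulr_ge0 ?expR_ge0 ?invr_ge0 ?sqr_ge0.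
have mD : measurable [set w | y < X w].
  rewrite (_ : [set _ | _] = setT `&` X @^-1` `]y, +oo[%classic); first exact: mX.
  by apply/seteqP; split=> w /=; rewrite in_itv/= andbT// => -[].
have mW : measurable_fun setT
    (fun w => X w ^+ 2 * expR (Num.max (X w) 0 `^ alpha)).
  apply: measurable_funM; first exact: measurable_funX.
  apply: measurableT_comp => //.
  apply: (measurableT_comp (measurable_powR _)).
  exact: measurable_maxr.
rewrite muleC -ge0_integralZl_EFin//; last 2 first.
- by move=> w _; rewrite lee_fin mulr_ge0 ?sqr_ge0 ?expR_ge0.
- exact/measurable_EFinP.
rewrite -(setIT [set w | y < X w]) -integral_indic//.
apply: ge0_le_integral => //.
- exact/measurable_EFinP.
- under eq_fun do rewrite -EFinM.
  by apply/measurable_EFinP; exact: measurable_funM.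
move=> w _; rewrite -EFinM lee_fin indicE; case: (boolP (_ \in _)) => [|_]; last first.
  by apply: (mulr_ge0 K0); rewrite mulr_ge0 ?sqr_ge0 ?expR_ge0.
rewrite inE/= => yX; have X0 : 0 < X w by exact: lt_trans yX.
rewrite /K expRN -invfM ler_pdivlMl ?mulr_gt0 ?exprn_gt0 ?expR_gt0// mulr1.
apply: ler_pM; rewrite ?sqr_ge0 ?expR_ge0//.
  by apply: lerXn2r; rewrite ?nnegrE ltW.
rewrite ler_expR; apply: ge0_ler_powR; rewrite ?nnegrE ?le_max ?lexx ?orbT//.
  exact: ltW.
by rewrite ltW.
Qed.

(** * The bound for a general truncation level *)

Lemma measurable_bounded_exists {d} {T : measurableType d} (n : nat)
  (Q : nat -> T -> Prop) :
  (forall k, (1 <= k <= n)%N -> measurable [set w | Q k w]) ->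
  measurable [set w | exists k, (1 <= k <= n)%N /\ Q k w].
Proof.
move=> mQ; rewrite (_ : [set _ | _] =
    \bigcup_(k in [set k | (1 <= k <= n)%N]) [set w | Q k w]).
  exact: bigcup_measurable.
by apply/seteqP; split=> w /= [k]; [move=> [kn Qk]|move=> /= kn Qk]; exists k.
Qed.

(** The level [y] is left free, so that both regimes of the theorem are instances. The two terms
    bound the walk with truncated jumps and the event that some jump exceeds [y]. *)
Lemma truncated_martingale_bound {d} {T : measurableType d} {R : realType}
  (P : probability T R) (n : nat) (F : nat -> set (set T))
  (xi : nat -> T -> R) (alpha : R) (V : nat -> T -> R) (x u y : R) :
  filtration_upto n F -> mart_diff P n F xi -> 0 < alpha < 1 ->
  (forall i, (1 <= i <= n)%N -> P.-integrable setT (EFin \o wsq alpha xi i)) ->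
  (forall i, (1 <= i <= n)%N ->
     cond_exp_version P (F i.-1) (wsq alpha xi i) (V i)) ->
  0 < y ->
  let lam := y `^ (alpha - 1) in
  (P [set w | exists k : nat, (1 <= k <= n)%N /\
        (x <= partial_sum xi k w)%R /\ (\sum_(1 <= i < k.+1) V i w <= u)%R] <=
   (expR (- (lam * x - lam ^+ 2 / 2 * u)))%:E +
   (\sum_(1 <= i < n.+1) \int[P]_w (wsq alpha xi i w)%:E) *
     (y ^- 2 * expR (- (y `^ alpha)))%:E)%E.
Proof.
move=> Ffilt [_ adxi ixi mgxi] a01 iW WV y0 /=; set lam := y `^ _.
have [sF _ _ _] := Ffilt.
have Fm k : (k <= n)%N -> F k `<=` measurable.
  exact: filtration_upto_measurable Ffilt.
have pred_le i : (1 <= i <= n)%N -> (i.-1 <= n)%N.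
  by case/andP=> _; exact: leq_trans (leq_pred i).
have mxi i : (1 <= i <= n)%N -> measurable_fun setT (xi i).
  by case/andP=> _ i_n; exact: measurable_wrt_fun (Fm _ i_n) (adxi _ i_n).
have mVF i : (1 <= i <= n)%N -> measurable_wrt (F i.-1) (V i).
  by move=> /WV[].
have mV i : (1 <= i <= n)%N -> measurable_fun setT (V i).
  by move=> i_n; exact: measurable_wrt_fun (Fm _ (pred_le _ i_n)) (mVF _ i_n).
pose s i w := lam * Num.min (xi i w) y.
pose v i w := lam ^+ 2 / 2 * V i w.
(* The least value of [lam S_k - (lam^2 / 2) Ups_k] allowed by [S_k >= x] and [Ups_k <= u]. *)
pose t := lam * x - lam ^+ 2 / 2 * u.
have ms i : (1 <= i <= n)%N -> measurable_wrt (F i) (s i).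
  case/andP=> _ i_n; apply/(measurable_wrtP _ (sF _ i_n)).
  apply: measurable_funM => //; apply: measurable_minr => //.
  exact/(measurable_wrtP _ (sF _ i_n))/adxi.
have mv i : (1 <= i <= n)%N -> measurable_wrt (F i.-1) (v i).
  move=> i_n; have sFi := sF _ (pred_le _ i_n).
  apply/(measurable_wrtP _ sFi); apply: measurable_funM => //.
  exact/(measurable_wrtP _ sFi)/mVF.
have msum (f : nat -> T -> R) k :
    (forall i, (1 <= i <= n)%N -> measurable_fun setT (f i)) -> (k <= n)%N ->
    measurable_fun setT (fun w => \sum_(1 <= i < k.+1) f i w).
  move=> mf; elim: k => [_|k ih kn].
    by under eq_fun do rewrite big_geq//; exact: measurable_cst.
  under eq_fun do rewrite big_nat_recr//=.
  by apply: measurable_funD; [exact/ih/ltnW|exact: mf].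
have mle (f : T -> R) (c : R) : measurable_fun setT f ->
    measurable [set w | c <= f w].
  by move=> mf; rewrite -(setTI [set _ | _]); exact: measurable_fun_le.
set E := [set w | _].
pose E1 := [set w | exists k, (1 <= k <= n)%N /\
  (t <= \sum_(1 <= i < k.+1) (s i w - v i w))%R].
(* The index is shifted by one because the union bound runs over [i < n], while the jumps are
   numbered from 1. *)
pose D i := [set w | y < xi i.+1 w].
have mE1 : measurable E1.
  apply: measurable_bounded_exists => k /andP[_ kn]; apply: mle.
  apply: msum => // i i_n; apply: measurable_funB.
    exact: measurable_wrt_fun (Fm _ (proj2 (andP i_n))) (ms _ i_n).
  exact: measurable_wrt_fun (Fm _ (pred_le _ i_n)) (mv _ i_n).
have mE : measurable E.
  apply: measurable_bounded_exists => k /andP[_ kn].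
  rewrite (_ : [set _ | _] = [set w | x <= partial_sum xi k w] `&`
    [set w | - u <= - \sum_(1 <= i < k.+1) V i w]).
    apply: measurableI; apply: mle; first exact: msum.
    by apply: measurable_funN; exact: msum.
  by apply/seteqP; split=> w /=; rewrite lerN2.
have mD i : (i < n)%N -> measurable (D i).
  move=> i_n; rewrite (_ : D i = ~` [set w | - y <= - xi i.+1 w]).
    by apply/measurableC/mle/measurable_funN/mxi.
  by apply/seteqP; split=> w /=; rewrite /D /= lerN2 ltNge => /negP.
pose E2 := \big[setU/set0]_(i < n) D i.
have mE2 : measurable E2 by apply: bigsetU_measurable => i _; exact: mD.
(* Outside [E2] no jump exceeds [y], so the minimum in [s] is inactive and the truncated sum is the
   partial sum itself. *)
have EE : E `<=` E1 `|` E2.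
  move=> w [k [/andP[k1 kn] [xS Vu]]].
  have [wE2|wE2] := pselect (E2 w); [by right|left].
  exists k; rewrite k1 kn; split=> //.
  rewrite sumrB -!mulr_sumr /t; apply: lerB.
    rewrite ler_wpM2l ?powR_ge0//; apply: le_trans xS _.
    rewrite /partial_sum le_eqVlt; apply/orP; left; apply/eqP.
    apply: eq_big_nat => i /andP[i1 ik]; apply/esym/min_idPl.
    rewrite leNgt; apply/negP => yxi; apply: wE2.
    have i_n : (i.-1 < n)%N by rewrite prednK// (leq_trans _ kn).
    rewrite /E2 -bigcup_mkord; exists i.-1 => //.
    by rewrite /D /= prednK.
  by rewrite ler_wpM2l ?divr_ge0 ?sqr_ge0.
apply: (@le_trans _ _ (P (E1 `|` E2))).
  by apply: le_measure; rewrite ?inE//; exact: measurableU.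
apply: (@le_trans _ _ (P E1 + P E2)%E); first exact: measureU2.
apply: leeD.
  apply: (exp_supermartingale_maximal P n F s v t Ffilt ms mv) => i i_n A FA.
  have FAm : measurable A by exact: Fm (pred_le _ i_n) _ FA.
  apply: (@cond_exp_expR_le _ _ _ _ (F i.-1) _ (xi i) (wsq alpha xi i) _ lam) => //.
  - apply: measurableT_comp => //; apply: measurable_funM => //.
    by apply: measurable_minr => //; exact: mxi.
  - by move=> w; exact: expR_trunc_le.
  - by apply: ixi; case/andP: i_n.
  - exact: iW.
  - exact: mgxi.
  - exact: WV.
apply: le_trans (Boole_inequality _ mD) _.
rewrite big_add1/= big_mkord ge0_sume_distrl; last first.
  move=> i _; apply: integral_ge0 => w _.
  by rewrite lee_fin mulr_ge0 ?sqr_ge0 ?expR_ge0.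
apply: lee_sum => i _; apply: weighted_tail_le => //.
  by case/andP: a01 => /ltW.
by apply: mxi; rewrite /= ltn_ord.
Qed.

(** * Choice of the truncation level *)

Theorem theorem2p1 (d : measure_display) (Omega : measurableType d)
  (R : realType) (P : probability Omega R) (n : nat)
  (F : nat -> set (set Omega)) (xi : nat -> Omega -> R) (alpha : R)
  (V : nat -> Omega -> R) (x u : R) :
  (1 <= n)%N ->
  filtration_upto n F ->
  mart_diff P n F xi ->
  0 < alpha < 1 ->
  (* C_n < oo *)
  (forall i, (1 <= i <= n)%N -> P.-integrable setT (EFin \o wsq alpha xi i)) ->
  (* V i = E[xi_i^2 exp{(xi_i^+)^alpha} | F_{i-1}] *)
  (forall i, (1 <= i <= n)%N ->
     cond_exp_version P (F i.-1) (wsq alpha xi i) (V i)) ->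
  0 < x -> 0 < u ->
  let Cn := (\sum_(1 <= i < n.+1) \int[P]_w (wsq alpha xi i w)%:E)%E in
  let Ups := fun k w => \sum_(1 <= i < k.+1) V i w in
  (P [set w | exists k : nat, (1 <= k <= n)%N /\
        (x <= partial_sum xi k w)%R /\ (Ups k w <= u)%R] <=
   if (x < powR u (1 / (2 - alpha)))%R then
     (expR (- (x ^+ 2 / (2 * u))))%:E
     + Cn * (powR (x / u) (2 / (1 - alpha))
             * expR (- powR (u / x) (alpha / (1 - alpha))))%:E
   else
     (expR (- (powR x alpha * (1 - u / (2 * powR x (2 - alpha))))))%:E
     + Cn * (x ^-2 * expR (- powR x alpha))%:E)%E.
Proof.
move=> _ Ffilt mxi a01 iW WV x0 u0 /=.
have [a0 a1] := andP a01.
have main y := truncated_martingale_bound P n F xi alpha V x u y Ffilt mxi a01 iW WV.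
case: ifPn => _.
  (* This level makes [lam = x / u], the minimiser of [- lam x + lam^2 u / 2], whose minimum is
     [- x^2 / (2 u)]. *)
  pose y := (u / x) `^ (1 / (1 - alpha)).
  have ux0 : 0 < u / x by rewrite divr_gt0.
  have yr r : y `^ r = (u / x) `^ (r / (1 - alpha)).
    by rewrite -powRrM mulrAC mul1r.
  have ux_inv r : (u / x) `^ (- r) = (x / u) `^ r.
    by rewrite -mulN1r powRrM powR_inv1 ?ltW// invf_div.
  have lamE : y `^ (alpha - 1) = x / u.
    rewrite yr -(opprB 1 alpha) mulNr divff ?subr_eq0 ?gt_eqF//.
    by rewrite powR_inv1 ?ltW// invf_div.
  have y2E : y ^- 2 = (x / u) `^ (2 / (1 - alpha)).
    by rewrite -powR_mulrn ?powR_ge0// yr -ux_inv powRN.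
  have /main : 0 < y by exact: powR_gt0.
  rewrite lamE y2E yr => /le_trans; apply.
  rewrite leeD2r// lee_fin ler_expR lerN2 le_eqVlt; apply/orP; left; apply/eqP.
  field; by rewrite !gt_eqF.
(* With [y = x] the product [lam x] is [x^alpha], so the jump term and the leading part of the first
   exponent have the same decay. *)
have /main/le_trans := x0; apply.
have p0 : 0 < x `^ alpha by exact: powR_gt0.
(* All powers are expressed through [x^alpha], which [field] can then treat as a nonzero atom. *)
have x2a : x `^ (2 - alpha) = x ^+ 2 / x `^ alpha.
  by rewrite powRB ?(gt_eqF x0) ?implybT// powR_mulrn ?ltW.
have xa1 : x `^ (alpha - 1) = x `^ alpha / x.
  by rewrite powRB ?(gt_eqF x0) ?implybT// powRr1 ?ltW.
rewrite leeD2r// lee_fin ler_expR lerN2 x2a xa1 le_eqVlt.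
apply/orP; left; apply/eqP; field.
by rewrite !gt_eqF.
Qed.
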